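(* Let $m,k\ge 0$ be integers with $k+m\ge 1$. For $x,y\in\mathbb{R}^{2m+2}$, $$(\Delta_y\Delta_x)^m\left[Z^{0}_{k+2m}(x,y)\right]=\widehat\beta_k^m\,Z_k^{m}(x,y),$$ where $$\widehat\beta_k^m=(-1)^m\,\frac{4^{2m}\,(k+2m)\,\Gamma(m+1)^3\,\Gamma(k+2m+1)}{(k+m)\,\Gamma(k+m+1)}.$$
   Context: $\Delta_x,\Delta_y$ are the Euclidean Laplacians of $\mathbb{R}^{2m+2}$ in the variables $x$ and $y$. Put $w=\frac{\langle x,y\rangle}{|x||y|}$. Gegenbauer polynomials: $C_k^\lambda(z)=\sum_{j=0}^{\lfloor k/2\rfloor}(-1)^j\frac{\Gamma(k-j+\lambda)}{\Gamma(\lambda)\,j!\,(k-2j)!}(2z)^{k-2j}$. For $\lambda>0$, $Z_p^\lambda(x,y)=\frac{p+\lambda}{\lambda}C_p^\lambda(w)(|x||y|)^p$. For $p\ge1$, $Z_p^0(x,y)=2T_p(w)(|x||y|)^p$ with $T_p$ the Chebyshev polynomial of the first kind (the formula for the zonal harmonic in dimension 2, evaluated here for $x,y\in\mathbb{R}^{2m+2}$). These are polynomials in $\langle x,y\rangle$ and $|x|^2|y|^2$, hence polynomial functions of $x,y$. $Z_k^m$ is the zonal harmonic of degree $k$ of $\mathbb{R}^{2m+2}$. *)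

(* Defs.v *)
From mathcomp Require Import all_boot all_order all_algebra.
From mathcomp Require Import all_classical all_reals all_analysis.

Set Implicit Arguments.
Unset Strict Implicit.
Unset Printing Implicit Defensive.

Import Order.TTheory GRing.Theory Num.Theory.
Import numFieldNormedType.Exports.

Local Open Scope classical_set_scope.
Local Open Scope ring_scope.

(* Euler's integral, which converges for 0 < s; it is only meant to be used at
   such arguments. *)
Definition Gamma (R : realType) (s : R) : R :=
  Rintegral (@lebesgue_measure R) [set` `]0, +oo[%R]
    (fun t : R => t `^ (s - 1) * expR (- t)).

Definition gegenbauer (R : realType) (lam : R) (k : nat) : {poly R} :=
  \sum_(0 <= j < (k./2).+1)
    ((-1) ^+ j * (Gamma ((k - j)%:R + lam)
                  / (Gamma lam * j`!%:R * (k - 2 * j)`!%:R)))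
      *: (2%:R *: 'X) ^+ (k - 2 * j).

Fixpoint chebyshevT (R : realType) (p : nat) : {poly R} :=
  match p with
  | 0 => 1
  | 1 => 'X
  | (q.+1 as r).+1 => 2%:R *: 'X * chebyshevT R r - chebyshevT R q
  end.

Definition inner (R : realType) (n : nat) (x y : 'rV[R]_n) : R :=
  \sum_(i < n) x 0 i * y 0 i.

(* The library norm `|x| on row vectors is the sup norm. *)
Definition enorm (R : realType) (n : nat) (x : 'rV[R]_n) : R :=
  Num.sqrt (inner x x).

(* For x = 0 or y = 0 the convention 0^-1 = 0 makes w = 0, and the factor
   (|x||y|)^p gives the value at that point of the polynomial in <x,y> and
   |x|^2|y|^2 (namely 0 if 0 < p, and 1 if p = 0 and 0 < lam).
   For lam = 0 the formula is the zonal harmonic only when 0 < p. *)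
Definition zonal (R : realType) (n : nat) (lam : R) (p : nat)
    (x y : 'rV[R]_n) : R :=
  let r := enorm x * enorm y in
  let w := inner x y / r in
  if lam == 0 then 2%:R * (chebyshevT R p).[w] * r ^+ p
  else (p%:R + lam) / lam * (gegenbauer lam p).[w] * r ^+ p.

Definition laplacian (R : realType) (n : nat) (f : 'rV[R]_n -> R)
    (x : 'rV[R]_n) : R :=
  \sum_(i < n) 'D_(delta_mx 0 i) ('D_(delta_mx 0 i) f) x.

Definition laplacian_x (R : realType) (n : nat)
    (F : 'rV[R]_n -> 'rV[R]_n -> R) : 'rV[R]_n -> 'rV[R]_n -> R :=
  fun x y => laplacian (fun x' => F x' y) x.

Definition laplacian_y (R : realType) (n : nat)
    (F : 'rV[R]_n -> 'rV[R]_n -> R) : 'rV[R]_n -> 'rV[R]_n -> R :=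
  fun x y => laplacian (fun y' => F x y') y.

Definition beta_hat (R : realType) (m k : nat) : R :=
  (-1) ^+ m * (4%:R ^+ (2 * m) * (k + 2 * m)%:R * Gamma (m%:R + 1) ^+ 3
               * Gamma ((k + 2 * m)%:R + 1))
  / ((k + m)%:R * Gamma ((k + m)%:R + 1)).

(* Main.v *)
(* Write n = 2m+2, s = <x,y>, u = |x|^2 |y|^2, and let H^l_q(s, u) be the
   homogenized Gegenbauer polynomial of degree q and integer parameter l, up to
   a normalization. For l = m it is harmonic in x and in y, whence
     Delta_y Delta_x (u^b H^m_q) = (4 b (b + m + q))^2 u^(b-1) H^m_q.
   Iterating the contiguity relation
     (q + l) H^l_q = H^(l+1)_q - u H^(l+1)_(q-2)
   m times from Z^0_p = p H^0_p, p = k + 2m, expresses Z^0_p as a combination of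
   the u^j H^m_(p-2j) with j <= m. The operator (Delta_y Delta_x)^m annihilates
   the terms with j < m and maps u^m H^m_k to a multiple of H^m_k. *)
Require Import Defs.
From mathcomp Require Import all_boot all_order all_algebra.
From mathcomp Require Import all_classical all_reals all_analysis.
From mathcomp Require Import measurable_realfun ring zify.
Import Order.TTheory GRing.Theory Num.Theory.
Import numFieldNormedType.Exports.
Local Open Scope ring_scope.

Set Implicit Arguments.
Unset Strict Implicit.
Unset Printing Implicit Defensive.

(** * The gamma function at positive integers *)

Lemma is_derive_expRN (R : realType) (t : R) :
  is_derive t (1 : R) (fun t : R => expR (- t)) (- expR (- t)).
Proof.
have hN : is_derive t (1 : R) (fun t : R => - t) (-1) by exact: is_deriveN.
have h := is_derive1_comp (is_derive_expR (- t)) hN.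
by apply: (is_derive_eq h); rewrite mulrN1.
Qed.

Lemma is_derive_powM_expRN (R : realType) (n : nat) (t : R) :
  is_derive t (1 : R) (fun t : R => t ^+ n * expR (- t))
    (n%:R * t ^+ n.-1 * expR (- t) - t ^+ n * expR (- t)).
Proof.
have he := is_derive_expRN t.
have hX : is_derive t (1 : R) (fun t : R => t ^+ n) (n%:R * t ^+ n.-1).
  have := is_deriveX n (is_derive_id t (1 : R)); rewrite exprfctE => h.
  by apply: (is_derive_eq h); rewrite /GRing.scale /= mulr1.
apply: (is_derive_eq (is_deriveM hX he)).
by rewrite /GRing.scale /=; ring.
Qed.

Lemma cvgy_powM_expRN (R : realType) (n : nat) :
  (t ^+ n * expR (- t) @[t --> +oo%R] --> (0 : R))%classic.
Proof.
(* The upper bound comes from e^t >= t^(n+1) / (n+1)! for t > 0. *)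
apply: (@squeeze_cvgr _ _ _ _ (cst 0) (fun t : R => n.+1`!%:R * t^-1)).
- near=> t.
  have t0 : 0 < t by near: t; exact: nbhs_pinfty_gt.
  rewrite mulr_ge0 ?exprn_ge0 ?expR_ge0 ?(ltW t0)//=.
  have f0 : 0 < n.+1`!%:R :> R by rewrite ltr0n fact_gt0.
  rewrite expRN ler_pdivrMr ?expR_gt0// mulrAC ler_pdivlMr// -exprSr.
  rewrite mulrC -ler_pdivrMr//.
  by apply: le_trans (expR_ge1Dxn n (ltW t0)); rewrite lerDr.
- exact: cvg_cst.
- rewrite -(mulr0 (n.+1`!%:R : R)); apply: cvgMr.
  apply/gtr0_cvgV0; first by near=> t; near: t; exact: nbhs_pinfty_gt.
  exact: cvg_id.
Unshelve. all: by end_near. Qed.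

(** Integration by parts gives F_(n+1) = (n+1) F_n - t^(n+1) e^(-t). Normalizing F to vanish at
    infinity makes Euler's integral equal to - F 0. *)
Lemma powM_expRN_antiderivative (R : realType) (n : nat) : exists F : R -> R,
  [/\ forall t, is_derive t (1 : R) F (t ^+ n * expR (- t)), F 0 = - n`!%:R
    & (F t @[t --> +oo%R] --> (0 : R))%classic].
Proof.
elim: n => [|n [F [dF F0 Fy]]].
  exists (fun t => - expR (- t)); split.
  - move=> t; apply: (is_derive_eq (is_deriveN (is_derive_expRN t))).
    by rewrite opprK expr0 mul1r.
  - by rewrite oppr0 expR0.
  - by rewrite -(oppr0 R); apply: cvgN; exact: cvgr_expR.
exists (fun t => n.+1%:R * F t - t ^+ n.+1 * expR (- t)); split.
- move=> t.
  have h := is_deriveM (is_derive_cst (n.+1%:R : R) t (1 : R)) (dF t).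
  apply: (is_derive_eq (is_deriveB h (is_derive_powM_expRN n.+1 t))).
  by rewrite /GRing.scale /=; ring.
- by rewrite F0 expr0n mul0r subr0 mulrN factS natrM.
- rewrite -(subr0 (0 : R)); apply: cvgB; last exact: cvgy_powM_expRN.
  by rewrite -(mulr0 (n.+1%:R : R)); apply: cvgMr.
Qed.

Lemma Gamma_fact (R : realType) (n : nat) : Gamma (n%:R + 1) = n`!%:R :> R.
Proof.
have [F [dF F0 Fy]] := powM_expRN_antiderivative R n.
have cF t : {for t, continuous F}.
  by apply/differentiable_continuous/derivable1_diffP; have [] := dF t.
have cf : continuous (fun t : R => t ^+ n * expR (- t)).
  move=> t; apply/differentiable_continuous/derivable1_diffP.
  by have [] := is_derive_powM_expRN n t.
rewrite /Gamma addrK.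
(* The real power agrees with the monomial on t > 0, and the monomial version is continuous on the
   whole line, as needed to close the interval at 0. *)
transitivity (Rintegral (@lebesgue_measure R) [set` `]0, +oo[%R]
    (fun t : R => t ^+ n * expR (- t))).
  apply: eq_Rintegral => t; rewrite inE/= in_itv/= andbT => t0.
  by rewrite powR_mulrn// ltW.
rewrite /Rintegral integral_itv_obnd_cbnd; last first.
  apply/measurable_EFinP; apply: measurable_funTS.
  exact: continuous_measurable_fun.
rewrite (@ge0_continuous_FTC2y _ _ F 0 0)//=.
- by rewrite F0 sub0r opprK.
- by move=> t t0; rewrite mulr_ge0 ?exprn_ge0 ?expR_ge0.
- exact: continuous_subspaceT.
- apply: cvg_at_right_filter; exact: cF.
- by move=> t _; rewrite derive1E; have [] := dF t.
Qed.

(** * Homogenized Gegenbauer polynomials and their recurrences *)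

Definition hcoef (R : realType) (l q j : nat) : R :=
  if (2 * j <= q)%N
  then (-1) ^+ j * (q - j + l).-1`!%:R / (j`!%:R * (q - 2 * j)`!%:R) else 0.

(* [(l - 1)!] times the Gegenbauer polynomial [C_q^l], homogenized in
   [s = <x,y>] and [u = |x|^2 |y|^2]. Unlike [C_q^l], it makes sense at [l = 0]
   as soon as [0 < q]. *)
Definition hgeg (R : realType) (l q : nat) (s u : R) : R :=
  \sum_(0 <= j < q./2.+1) hcoef R l q j * (2 * s) ^+ (q - 2 * j) * u ^+ j.

Lemma fact_neq0 (R : realType) (n : nat) : n`!%:R != 0 :> R.
Proof. by rewrite pnatr_eq0 -lt0n fact_gt0. Qed.

Lemma hcoef_out (R : realType) (l q j : nat) :
  (q < 2 * j)%N -> hcoef R l q j = 0.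
Proof. by rewrite /hcoef ltnNge => /negbTE ->. Qed.

Lemma hgeg_widen (R : realType) (l q N : nat) (s u : R) : (q./2 < N)%N ->
  hgeg l q s u
    = \sum_(0 <= j < N) hcoef R l q j * (2 * s) ^+ (q - 2 * j) * u ^+ j.
Proof.
move=> qN; rewrite (big_cat_nat (leq0n _) qN)/= [X in _ + X]big_nat_cond.
rewrite [X in _ + X]big1 ?addr0// => j /andP[/andP[qj _] _].
by rewrite hcoef_out ?mul0r//; lia.
Qed.

(** This ratio of consecutive coefficients is what makes H^m_q harmonic in dimension 2m+2. When j+1
    is out of range, q - 2j is 0 or 1 and both sides vanish. *)
Lemma hcoefS (R : realType) (l q j : nat) : (2 * j <= q)%N ->
  j.+1%:R * (q - j + l).-1%:R * hcoef R l q j.+1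
    = - ((q - 2 * j) * (q - 2 * j).-1)%:R * hcoef R l q j.
Proof.
move=> jq; rewrite /hcoef jq; case: (leqP (2 * j.+1) q) => [jq'|jq']; last first.
  have : (q - 2 * j <= 1)%N by lia.
  by case: (q - 2 * j)%N => [|[|//]] _; rewrite ?mul0n ?muln0 oppr0 mulr0 mul0r.
have [r ->] : exists r, q = (r + 2 + 2 * j)%N by exists (q - 2 * j.+1)%N; lia.
have -> : (r + 2 + 2 * j - j + l).-1 = (r + j + l).+1 by lia.
have -> : (r + 2 + 2 * j - j.+1 + l).-1 = (r + j + l)%N by lia.
have -> : (r + 2 + 2 * j - 2 * j.+1)%N = r by lia.
rewrite addnK addn2 /= !factS !natrM exprS.
by field; rewrite !fact_neq0 ?nat1r -?natrD !pnatr_eq0.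
Qed.

(** Compare the coefficients of u^(j+1): with q = r + 2j, after division by the common factorials,
    the identity is r + 2j + 2 + l = (r + j + l + 1) + (j + 1). The normalization by (l-1)! removes
    any factor l, so the case l = 0 is included. *)
Lemma hgeg_lift (R : realType) (l q : nat) (s u : R) :
  (q.+2 + l)%:R * hgeg l q.+2 s u
    = hgeg l.+1 q.+2 s u - u * hgeg l.+1 q s u.
Proof.
rewrite /hgeg /= !(big_nat_recl q./2.+1)//= mulrDr mulr_sumr mulr_sumr.
rewrite -addrA -sumrB; congr (_ + _).
  rewrite /hcoef muln0/= !subn0 !expr0 !mul1r !mulr1 addnS/= addSn /= factS natrM.
  by rewrite [(_ + _).+1`!]factS natrM !mulrA.
rewrite big_nat_cond [RHS]big_nat_cond; apply: eq_bigr => j /andP[/andP[_ jq] _].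
have jq2 : (2 * j <= q)%N by lia.
have jq3 : (2 * j.+1 <= q.+2)%N by lia.
rewrite /hcoef jq2 jq3.
have [r ->] : exists r, q = (r + 2 * j)%N by exists (q - 2 * j)%N; lia.
have -> : ((r + 2 * j).+2 - j.+1 + l).-1 = (r + j + l)%N by lia.
have -> : ((r + 2 * j).+2 - j.+1 + l.+1).-1 = (r + j + l).+1 by lia.
have -> : ((r + 2 * j) - j + l.+1).-1 = (r + j + l)%N by lia.
have -> : ((r + 2 * j).+2 - 2 * j.+1)%N = r by lia.
rewrite addnK !factS !natrM !exprS.
by field; rewrite !fact_neq0 ?nat1r -?natrD !pnatr_eq0.
Qed.

(** For l = 1 these are the homogenized Chebyshev polynomials of the second kind, with their
    three-term recurrence. *)
Lemma hgeg1_rec (R : realType) (q : nat) (s u : R) :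
  hgeg 1 q.+2 s u = 2 * s * hgeg 1 q.+1 s u - u * hgeg 1 q s u.
Proof.
(* The sum of degree q+1 is padded to the length of that of degree q+2, whatever the parity of q. *)
rewrite (@hgeg_widen _ _ q.+1 q./2.+2); last by lia.
rewrite /hgeg /= !(big_nat_recl q./2.+1)//= mulrDr mulr_sumr mulr_sumr.
rewrite -addrA -sumrB; congr (_ + _).
  rewrite /hcoef muln0/= !subn0 !expr0 !mul1r !mulr1 !addn1/=.
  by rewrite !divff ?fact_neq0// !mul1r exprS.
rewrite big_nat_cond [RHS]big_nat_cond; apply: eq_bigr => j /andP[/andP[_ jq] _].
have jq2 : (2 * j <= q)%N by lia.
have jq3 : (2 * j.+1 <= q.+2)%N by lia.
rewrite /hcoef jq2 jq3.
have [r ->] : exists r, q = (r + 2 * j)%N by exists (q - 2 * j)%N; lia.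
have -> : ((r + 2 * j).+2 - j.+1 + 1).-1 = (r + j).+1%N by lia.
have -> : ((r + 2 * j) - j + 1).-1 = (r + j)%N by lia.
have -> : ((r + 2 * j).+2 - 2 * j.+1)%N = r by lia.
(* For r = 0 the monomial is a pure power of u, to which the term in 2s contributes nothing. *)
rewrite addnK; case: r => [|r].
  rewrite ifF; last by lia.
  rewrite !mul0r mulr0 sub0r add0n factS natrM !exprS !fact0.
  by field; rewrite !fact_neq0 ?nat1r -?natrD !pnatr_eq0.
rewrite ifT; last by lia.
have -> : ((r.+1 + 2 * j).+1 - 2 * j.+1)%N = r by lia.
rewrite addSn !factS !natrM !exprS.
by field; rewrite !fact_neq0 ?nat1r -?natrD !pnatr_eq0.
Qed.

(** This is 2 T_(q+2) = U_(q+2) - U_q, homogenized: both sides obey the same three-term recurrence,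
    so two consecutive degrees are carried through the induction. *)
Lemma chebyshevT_hgeg1 (R : realType) (q : nat) (w r : R) :
  2 * (chebyshevT R q.+2).[w] * r ^+ q.+2
    = hgeg 1 q.+2 (w * r) (r ^+ 2) - r ^+ 2 * hgeg 1 q (w * r) (r ^+ 2).
Proof.
have cT p : (chebyshevT R p.+2).[w]
    = 2 * w * (chebyshevT R p.+1).[w] - (chebyshevT R p).[w].
  by rewrite /= !hornerE.
have h0 : hgeg 1 0 (w * r) (r ^+ 2) = 1.
  by rewrite /hgeg big_nat1 /hcoef /= !expr0 fact0; field.
have h1 : hgeg 1 1 (w * r) (r ^+ 2) = 2 * (w * r).
  by rewrite /hgeg big_nat1 /hcoef /= !expr0 !fact0; field.
pose P q := 2 * (chebyshevT R q.+2).[w] * r ^+ q.+2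
    = hgeg 1 q.+2 (w * r) (r ^+ 2) - r ^+ 2 * hgeg 1 q (w * r) (r ^+ 2).
suff: P q /\ P q.+1 by case.
elim: q => [|q [Pq PSq]].
  have T0 : (chebyshevT R 0).[w] = 1 by rewrite /= hornerE.
  have T1 : (chebyshevT R 1).[w] = w by rewrite /= hornerE.
  by rewrite /P !cT T1 T0 !hgeg1_rec h0 h1; split; ring.
split=> //; rewrite /P cT hgeg1_rec (hgeg1_rec q).
move: Pq PSq; rewrite /P => Pq PSq.
have -> : 2 * (2 * w * (chebyshevT R q.+3).[w] - (chebyshevT R q.+2).[w])
    * r ^+ q.+4
   = 2 * (w * r) * (2 * (chebyshevT R q.+3).[w] * r ^+ q.+3)
     - r ^+ 2 * (2 * (chebyshevT R q.+2).[w] * r ^+ q.+2) by rewrite !exprS; ring.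
by rewrite Pq PSq (hgeg1_rec q); ring.
Qed.

Lemma chebyshevT_hgeg0 (R : realType) (q : nat) (w r : R) : (0 < q)%N ->
  2 * (chebyshevT R q).[w] * r ^+ q = q%:R * hgeg 0 q (w * r) (r ^+ 2).
Proof.
case: q => [//|[_|q _]].
  rewrite [chebyshevT R 1]/= hornerX /hgeg big_nat1 /hcoef /=.
  by rewrite addn0 muln0 subn0 !fact0 (_ : 1`! = 1%N)// !expr1 !expr0; field.
by rewrite (chebyshevT_hgeg1 q w r) -hgeg_lift addn0.
Qed.

(* Only the top coefficient matters: the m-fold operator kills the terms with
   [j < m]. *)
Lemma hgeg_connection (R : realType) (p l : nat) :
  (2 * l <= p)%N -> (0 < p)%N -> exists c : nat -> R,
    c l = (-1) ^+ l * (p * (p - l)`!)%:R / p`!%:R /\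
    forall s u, p%:R * hgeg 0 p s u
      = \sum_(0 <= j < l.+1) c j * u ^+ j * hgeg l (p - 2 * j) s u.
Proof.
move=> + p0; elim: l => [|l IH] lp.
  exists (fun=> p%:R); rewrite subn0 expr0 mul1r natrM mulfK ?fact_neq0//.
  by split=> // s u; rewrite big_nat1 expr0 mulr1 muln0 subn0.
have [|c [cl cE]] := IH; first lia.
(* [hgeg_lift] in degree p - 2j divides by p - 2j + l and replaces the j-th term by one of index j
   and one of index j+1. Hence the new coefficients d_j - d_(j-1), and the top one - d_l = - c_l /
   (p - l). *)
pose d j : R := c j / (p - 2 * j + l)%:R.
exists (fun j => (if (j <= l)%N then d j else 0) - (if j is i.+1 then d i else 0)).
split.
  rewrite ltnn /d cl sub0r exprS.
  have -> : (p - 2 * l + l = (p - l.+1).+1)%N by lia.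
  have -> : (p - l = (p - l.+1).+1)%N by lia.
  rewrite factS !natrM; field.
  by rewrite nat1r fact_neq0 pnatr_eq0.
move=> s u; rewrite cE.
transitivity (\sum_(0 <= j < l.+1) d j * u ^+ j *
    (hgeg l.+1 (p - 2 * j) s u - u * hgeg l.+1 (p - 2 * j.+1) s u)).
  rewrite big_nat_cond [RHS]big_nat_cond; apply: eq_bigr.
  move=> j /andP[/andP[_ jl] _].
  have [q pq] : exists q, (p - 2 * j)%N = q.+2 by exists (p - 2 * j - 2)%N; lia.
  have -> : (p - 2 * j.+1)%N = q by lia.
  rewrite /d pq -hgeg_lift; field.
  by rewrite -?natrD pnatr_eq0.
under eq_bigr do rewrite mulrBr.
rewrite sumrB; under [RHS]eq_bigr do rewrite 2!mulrBl.
rewrite sumrB; congr (_ - _).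
  rewrite [RHS]big_nat_recr//= ltnn !mul0r addr0.
  by apply: eq_big_nat => j /andP[_ jl]; rewrite -ltnS jl.
rewrite [RHS]big_nat_recl//= !mul0r add0r.
by apply: eq_bigr => j _; rewrite exprS; ring.
Qed.

(** * Directional derivatives and Laplacians of monomials in <x,y> and |x|^2 *)

Lemma is_derive_coord (R : realType) (n : nat) (i : 'I_n) (x v : 'rV[R]_n) :
  is_derive x v (fun x : 'rV[R]_n => x 0 i) (v 0 i).
Proof.
have did : derivable (@id 'rV[R]_n) x v by exact: derivable_id.
have di : derivable (fun x : 'rV[R]_n => x 0 i) x v.
  by move/derivable_mxP: did; apply.
apply: DeriveDef => //.
by have := derive_mx did; rewrite derive_id => /matrixP/(_ 0 i); rewrite mxE.
Qed.

Lemma innerC (R : realType) (n : nat) (x y : 'rV[R]_n) : inner x y = inner y x.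
Proof. by apply: eq_bigr => i _; rewrite mulrC. Qed.

Lemma is_derive_innerl (R : realType) (n : nat) (x v y : 'rV[R]_n) :
  is_derive x v (fun x => inner x y) (inner v y).
Proof.
have h i : is_derive x v (fun x : 'rV[R]_n => x 0 i * y 0 i) (v 0 i * y 0 i).
  have := is_deriveM (is_derive_coord i x v) (is_derive_cst (y 0 i) x v).
  by move=> h; apply: (is_derive_eq h); rewrite /GRing.scale /=; ring.
have := is_derive_sum h.
by rewrite fct_sumE.
Qed.

Lemma is_derive_inner (R : realType) (n : nat) (x v : 'rV[R]_n) :
  is_derive x v (fun x => inner x x) (2 * inner v x).
Proof.
have h i : is_derive x v (fun x : 'rV[R]_n => x 0 i * x 0 i) (2 * (v 0 i * x 0 i)).
  have hi := is_derive_coord i x v.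
  by apply: (is_derive_eq (is_deriveM hi hi)); rewrite /GRing.scale /=; ring.
have := is_derive_sum h.
by rewrite fct_sumE -mulr_sumr.
Qed.

(** With y fixed, u^b H^m_q is a linear combination of these functions of x, and their span is
    stable under the Laplacian. *)
Definition monom (R : realType) (n : nat) (y : 'rV[R]_n) (a b : nat)
    (x : 'rV[R]_n) : R := inner x y ^+ a * inner x x ^+ b.

Lemma is_derive_monom (R : realType) (n : nat) (y : 'rV[R]_n) (a b : nat)
    (x v : 'rV[R]_n) :
  is_derive x v (monom y a b)
    (a%:R * inner v y * monom y a.-1 b x
     + 2 * b%:R * inner v x * monom y a b.-1 x).
Proof.
have := is_deriveM (is_deriveX a (is_derive_innerl x v y))
                   (is_deriveX b (is_derive_inner x v)).
rewrite !exprfctE => h.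
by apply: (is_derive_eq h); rewrite /monom /GRing.scale /=; ring.
Qed.

Lemma is_derive2_monom (R : realType) (n : nat) (y : 'rV[R]_n) (a b : nat)
    (x v : 'rV[R]_n) :
  is_derive x v ('D_v (monom y a b))
    ((a * a.-1)%:R * inner v y ^+ 2 * monom y a.-2 b x
     + 4 * (a * b)%:R * (inner v x * inner v y) * monom y a.-1 b.-1 x
     + 2 * b%:R * inner v v * monom y a b.-1 x
     + 4 * (b * b.-1)%:R * inner v x ^+ 2 * monom y a b.-2 x).
Proof.
have -> : 'D_v (monom y a b) = fun x => 
    a%:R * inner v y * monom y a.-1 b x
     + 2 * b%:R * inner v x * monom y a b.-1 x.
  by apply/funext => z; have [] := is_derive_monom y a b z v.
have h1 := is_deriveM (is_derive_cst (a%:R * inner v y) x v)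
   (is_derive_monom y a.-1 b x v).
have hv : is_derive x v (inner v) (inner v v).
  have -> : inner v = (fun x => inner x v) by apply/funext => z; exact: innerC.
  exact: is_derive_innerl.
have h2 := is_deriveM (is_deriveM (is_derive_cst (2 * b%:R : R) x v) hv)
   (is_derive_monom y a b.-1 x v).
apply: (is_derive_eq (is_deriveD h1 h2)).
rewrite /GRing.scale /= ?fctE /cst !natrM.
have key (A A' B B' s t w p q q' r z : R) :
  A * s * (A' * s * p + 2 * B * t * q) + q' * 0
  + (2 * B * t * (A * s * q + 2 * B' * t * r) + z * (2 * B * w + t * 0))
  = A * A' * s ^+ 2 * p + 4 * (A * B) * (t * s) * q + 2 * B * w * z
    + 4 * (B * B') * t ^+ 2 * r.
  by ring.
exact: key.
Qed.

Lemma inner_delta (R : realType) (n : nat) (i : 'I_n) (y : 'rV[R]_n) :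
  inner (delta_mx 0 i) y = y 0 i.
Proof.
rewrite /inner (bigD1 i)//= big1 ?addr0 => [|j ji];
  rewrite mxE eqxx/= ?eqxx ?mul1r//.
by rewrite (negbTE ji) mul0r.
Qed.

Lemma laplacian_monom (R : realType) (n : nat) (y : 'rV[R]_n) (a b : nat)
    (x : 'rV[R]_n) :
  laplacian (monom y a b) x
    = (a * a.-1)%:R * inner y y * monom y a.-2 b x
      + (2 * b * (n + 2 * a + 2 * b.-1))%:R * monom y a b.-1 x.
Proof.
rewrite /laplacian.
under eq_bigr => i _.
  have [_ ->] := is_derive2_monom y a b x (delta_mx 0 i).
  rewrite !inner_delta mxE !eqxx/= mulr1.
  over.
rewrite !big_split/=.
have -> : \sum_(i < n) (a * a.-1)%:R * y 0 i ^+ 2 * monom y a.-2 b x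
    = (a * a.-1)%:R * inner y y * monom y a.-2 b x.
  by rewrite -mulr_suml -mulr_sumr.
have -> : \sum_(i < n) 4 * (a * b)%:R * (x 0 i * y 0 i) * monom y a.-1 b.-1 x
    = 4 * (a * b)%:R * inner x y * monom y a.-1 b.-1 x.
  by rewrite -mulr_suml -mulr_sumr.
have -> : \sum_(i < n) 4 * (b * b.-1)%:R * x 0 i ^+ 2 * monom y a b.-2 x
    = 4 * (b * b.-1)%:R * inner x x * monom y a b.-2 x.
  by rewrite -mulr_suml -mulr_sumr.
rewrite sumr_const card_ord -mulr_natl /monom.
(* Small exponents are separated because predecessors are truncated: there the coefficient vanishes
   instead. *)
case: a b => [|a] [|[|b]] /=; rewrite ?exprS !natrM ?natrD ?natrM; ring.
Qed.

(** The regularity under which the Laplacian is shown to commute with finite linear combinations. *)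
Definition twice_derivable (R : realType) (n : nat) (f : 'rV[R]_n -> R) :=
  forall x v, derivable f x v /\ derivable ('D_v f) x v.

Lemma twice_derivable_monom (R : realType) (n : nat) (y : 'rV[R]_n) (a b : nat) :
  twice_derivable (monom y a b).
Proof.
move=> x v; split; first by have [] := is_derive_monom y a b x v.
by have [] := is_derive2_monom y a b x v.
Qed.

Lemma derive2_lincomb (R : realType) (n N : nat) (c : 'I_N -> R)
    (f : 'I_N -> 'rV[R]_n -> R) (x v : 'rV[R]_n) :
  (forall i, twice_derivable (f i)) ->
  is_derive x v (fun x => \sum_(i < N) c i * f i x)
    (\sum_(i < N) c i * 'D_v (f i) x)
  /\ is_derive x v ('D_v (fun x => \sum_(i < N) c i * f i x))
       (\sum_(i < N) c i * 'D_v ('D_v (f i)) x).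
Proof.
move=> df.
have sum_derive (g : 'I_N -> 'rV[R]_n -> R) z : (forall i, derivable (g i) z v) ->
    is_derive z v (fun x => \sum_(i < N) c i * g i x)
      (\sum_(i < N) c i * 'D_v (g i) z).
  move=> dg; have h i : is_derive z v (fun x => c i * g i x) (c i * 'D_v (g i) z).
    have := is_deriveM (is_derive_cst (c i) z v) (derivableP (dg i)).
    by move=> h; apply: (is_derive_eq h); rewrite /GRing.scale/= mulr0 addr0.
  by have := is_derive_sum h; rewrite fct_sumE.
split; first by apply: sum_derive => i; have [] := df i x v.
have -> : 'D_v (fun x => \sum_(i < N) c i * f i x)
    = fun x => \sum_(i < N) c i * 'D_v (f i) x.
  apply/funext => z; have [] // := sum_derive f z _.
  by move=> i; have [] := df i z v.
by apply: sum_derive => i; have [] := df i x v.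
Qed.

Lemma twice_derivable_lincomb (R : realType) (n N : nat) (c : 'I_N -> R)
    (f : 'I_N -> 'rV[R]_n -> R) :
  (forall i, twice_derivable (f i)) ->
  twice_derivable (fun x => \sum_(i < N) c i * f i x).
Proof.
by move=> df x v; have [[? _] [? _]] := derive2_lincomb c x v df.
Qed.

Lemma laplacian_lincomb (R : realType) (n N : nat) (c : 'I_N -> R)
    (f : 'I_N -> 'rV[R]_n -> R) (x : 'rV[R]_n) :
  (forall i, twice_derivable (f i)) ->
  laplacian (fun x => \sum_(i < N) c i * f i x) x
    = \sum_(i < N) c i * laplacian (f i) x.
Proof.
move=> df; rewrite /laplacian.
under eq_bigr => j _.
  have [_ [_ ->]] := derive2_lincomb c x (delta_mx 0 j) df.
  over.
by rewrite exchange_big/=; apply: eq_bigr => i _; rewrite mulr_sumr.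
Qed.

(** * Zonal functions in terms of homogenized Gegenbauer polynomials *)

Lemma Gamma_nat (R : realType) (n : nat) : (0 < n)%N ->
  Gamma n%:R = n.-1`!%:R :> R.
Proof. by case: n => // n _; rewrite -[n.+1]addn1 natrD Gamma_fact addn1. Qed.

Lemma gegenbauer_hgeg (R : realType) (l q : nat) (w r : R) : (0 < l)%N ->
  (gegenbauer l%:R q).[w] * r ^+ q
    = l.-1`!%:R^-1 * hgeg l q (w * r) (r ^+ 2).
Proof.
move=> l0; rewrite /gegenbauer horner_sum mulr_suml mulr_sumr.
apply: eq_big_nat => j /andP[_ jq].
have jq2 : (2 * j <= q)%N by lia.
rewrite hornerZ horner_exp hornerZ hornerX -natrD !Gamma_nat//; last by lia.
rewrite /hcoef jq2 -[in r ^+ q](subnK jq2) exprD exprM !exprMn.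
by field; rewrite !fact_neq0.
Qed.

Lemma enorm_sqr (R : realType) (n : nat) (x : 'rV[R]_n) :
  enorm x ^+ 2 = inner x x.
Proof. by rewrite sqr_sqrtr// sumr_ge0// => i _; rewrite -expr2 sqr_ge0. Qed.

Lemma enorm_eq0 (R : realType) (n : nat) (x y : 'rV[R]_n) :
  enorm x = 0 -> inner x y = 0.
Proof.
move=> x0; have /eqP := enorm_sqr x; rewrite x0 expr0n /= eq_sym.
rewrite /inner psumr_eq0 => [/allP x00|i _]; last by rewrite -expr2 sqr_ge0.
apply: big1 => i _; have := x00 i (mem_index_enum i).
by rewrite mulf_eq0 orbb => /eqP ->; rewrite mul0r.
Qed.

(** For l > 0 the factor is (q + l) / l times 1 / (l-1)!; for l = 0 it reduces to the q of
    [chebyshevT_hgeg0]. One formula thus covers both branches of [zonal]. *)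
Lemma zonal_hgeg (R : realType) (n l q : nat) (x y : 'rV[R]_n) :
  (0 < q + l)%N ->
  zonal l%:R q x y
    = (q + l)%:R / l`!%:R * hgeg l q (inner x y) (inner x x * inner y y).
Proof.
move=> ql; rewrite /zonal.
set r := enorm x * enorm y; set w := inner x y / r.
have <- : w * r = inner x y.
  (* If |x||y| = 0, then w * r = 0, and <x,y> = 0 since one of the vectors is zero. *)
  have [r0|r0] := eqVneq r 0; last by rewrite /w divfK.
  rewrite r0 mulr0; move/eqP: r0; rewrite mulf_eq0 => /orP[] /eqP /enorm_eq0 h.
    by rewrite h.
  by rewrite innerC h.
have <- : r ^+ 2 = inner x x * inner y y by rewrite exprMn !enorm_sqr.
rewrite pnatr_eq0; case: eqP => [l0|/eqP l0].
  rewrite l0 addn0 in ql *.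
  by rewrite chebyshevT_hgeg0// fact0 divr1.
rewrite -mulrA gegenbauer_hgeg ?lt0n// -natrD.
by case: l l0 {ql} => // l _; rewrite factS natrM /= invfM !mulrA.
Qed.

(** * The action of the Laplacians on u^b H^m_q *)

Lemma hgeg_monom (R : realType) (n m q b : nat) (x y : 'rV[R]_n) :
  inner x x ^+ b * hgeg m q (inner x y) (inner x x * inner y y)
    = \sum_(i < q./2.+1) (hcoef R m q i * 2 ^+ (q - 2 * i) * inner y y ^+ i)
                         * monom y (q - 2 * i) (b + i) x.
Proof.
rewrite /hgeg big_mkord mulr_sumr; apply: eq_bigr => i _.
by rewrite /monom !exprMn exprD; ring.
Qed.

Lemma twice_derivable_hgeg (R : realType) (n m q b : nat) (y : 'rV[R]_n) :
  twice_derivable (fun x : 'rV[R]_n =>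
    inner x x ^+ b * hgeg m q (inner x y) (inner x x * inner y y)).
Proof.
under eq_fun do rewrite hgeg_monom.
by apply: twice_derivable_lincomb => i; exact: twice_derivable_monom.
Qed.

(** The constant is the classical 2b (n + 2q + 2b - 2) for |x|^(2b) times a harmonic homogeneous
    polynomial of degree q. The case b = 0 is harmonicity itself; all b are treated at once on
    coefficients. *)
Lemma laplacian_hgeg (R : realType) (n m q b : nat) (x y : 'rV[R]_n) :
  n = (2 * m + 2)%N ->
  laplacian (fun x : 'rV[R]_n =>
      inner x x ^+ b * hgeg m q (inner x y) (inner x x * inner y y)) x
    = (4 * (b * (b + m + q)))%:R *
      (inner x x ^+ b.-1 * hgeg m q (inner x y) (inner x x * inner y y)).
Proof.
move=> hn; under [X in laplacian X _]eq_fun do rewrite hgeg_monom.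
rewrite laplacian_lincomb; last by move=> i; exact: twice_derivable_monom.
under eq_bigr do rewrite laplacian_monom.
rewrite hgeg_monom mulr_sumr.
(* The i-th summands of the two sides differ by [t i - t i.+1]. *)
pose t (i : nat) : R := 4 * (i%:R * (q - i.-1 + m).-1%:R * hcoef R m q i)
  * 2 ^+ (q - 2 * i) * inner y y ^+ i * inner x y ^+ (q - 2 * i)
  * inner x x ^+ (b + i).-1.
(* The telescoping sum is zero: [t] vanishes at 0 by its factor i, and at q/2 + 1 because the
   coefficient is out of range. *)
apply/eqP; rewrite -subr_eq0 -sumrB -[X in _ == X](_ : t 0%N - t q./2.+1 = 0);
  last first.
  rewrite /t (@hcoef_out _ m q q./2.+1); last by lia.
  by rewrite !(mulr0, mul0r) subrr.
rewrite -opprB -(telescope_sumr _ (leq0n _)) -sumrN big_mkord.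
apply/eqP/eq_bigr => -[i /= iq] _.
have jq2 : (2 * i <= q)%N by lia.
have hS := hcoefS R m jq2; rewrite /t /monom.
have -> : (q - 2 * i.+1 = (q - 2 * i).-2)%N by lia.
have -> : i%:R * (q - i.-1 + m).-1%:R = (i * (q - i + m))%:R :> R.
  rewrite -natrM; congr _%:R; case: i {iq hS} jq2 => // i jq2.
  by congr (_ * _)%N; lia.
rewrite hS addnS /=.
(* For n = 2m + 2 this is 4(b+i)(b+m+q-i) = 4i(q-i+m) + 4b(b+m+q): the first part is absorbed by
   [t i], the second is the claimed eigenvalue. The exponents (b+i)-1 and (b-1)+i, truncated at 0,
   may differ only for b = 0, where the second part vanishes. *)
have key2 : (2 * (b + i) * (n + 2 * (q - 2 * i) + 2 * (b + i).-1))%:R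
    * inner x x ^+ (b + i).-1
  = (4 * (i * (q - i + m)))%:R * inner x x ^+ (b + i).-1
    + (4 * (b * (b + m + q)))%:R * inner x x ^+ (b.-1 + i).
  move: (inner x x) => X; rewrite hn; case: (posnP b) => [->|b0].
    rewrite mul0n muln0 mul0r addr0 !add0n; congr (_%:R * _).
    by case: i {iq hS} jq2 => // i jq2; nia.
  have -> : (b.-1 + i = (b + i).-1)%N by lia.
  rewrite -mulrDl -natrD; congr (_%:R * _).
  have [a ->] : exists a, q = (a + 2 * i)%N by exists (q - 2 * i)%N; lia.
  rewrite addnK; case: b {t} b0 => // b _; rewrite addSn /=.
  have -> : (a + 2 * i - i = a + i)%N by lia.
  lia.
have key3 : ((q - 2 * i) * (q - 2 * i).-1)%:R * 2 ^+ (q - 2 * i)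
    = ((q - 2 * i) * (q - 2 * i).-1)%:R * 4 * 2 ^+ (q - 2 * i).-2 :> R.
  case: (q - 2 * i)%N => [|[|a]]; rewrite ?mul0n ?muln0 ?mul0r//= !exprS.
  by ring.
move: key2 key3.
move: (q - 2 * i)%N => a.
set A := (a * a.-1)%:R; set B := (X in X * _ ^+ (b + i).-1 = _).
set C := (_ * (_ * (_ + _)))%:R.
move: (inner x x ^+ (b + i).-1) (inner x x ^+ (b.-1 + i)) => X1 X2 key2 key3.
set D := (4 * (b * (b + m + q)))%:R.
transitivity (hcoef R m q i * inner y y ^+ i * (A * 2 ^+ a) * inner y y
    * inner x y ^+ a.-2 * inner x x ^+ (b + i)
  + hcoef R m q i * 2 ^+ a * inner y y ^+ i * inner x y ^+ a * (B * X1 - D * X2)).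
  by rewrite -/B; ring.
by rewrite key2 key3 /C natrM exprS; ring.
Qed.

Lemma laplacian_hgeg_sum (R : realType) (n m N : nat) (c : 'I_N -> R)
    (b q : 'I_N -> nat) (x y : 'rV[R]_n) :
  n = (2 * m + 2)%N ->
  laplacian (fun x : 'rV[R]_n => \sum_(i < N) c i * (inner x x ^+ b i
      * hgeg m (q i) (inner x y) (inner x x * inner y y))) x
    = \sum_(i < N) c i * (4 * (b i * (b i + m + q i)))%:R
        * (inner x x ^+ (b i).-1
           * hgeg m (q i) (inner x y) (inner x x * inner y y)).
Proof.
move=> hn; rewrite laplacian_lincomb => [|i]; last exact: twice_derivable_hgeg.
by apply: eq_bigr => i _; rewrite laplacian_hgeg// mulrA.
Qed.

Lemma bilaplacian_hgeg_sum (R : realType) (n m N : nat) (c : 'I_N -> R)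
    (b q : 'I_N -> nat) :
  n = (2 * m + 2)%N ->
  laplacian_y (laplacian_x (fun x y : 'rV[R]_n => \sum_(i < N) c i
      * ((inner x x * inner y y) ^+ b i
         * hgeg m (q i) (inner x y) (inner x x * inner y y))))
  = fun x y => \sum_(i < N) c i * (4 * (b i * (b i + m + q i)))%:R ^+ 2
      * ((inner x x * inner y y) ^+ (b i).-1
         * hgeg m (q i) (inner x y) (inner x x * inner y y)).
Proof.
move=> hn; rewrite /laplacian_y /laplacian_x; apply/funext => x; apply/funext => y.
(* The Laplacian in x lowers only the exponent of |x|^2. The symmetry of s and u in x and y then
   puts the result in the form required by the same lemma in y. *)
have -> : (fun y' : 'rV[R]_n => laplacian (fun x' => \sum_(i < N) c i
      * ((inner x' x' * inner y' y') ^+ b i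
         * hgeg m (q i) (inner x' y') (inner x' x' * inner y' y'))) x)
  = fun y' => \sum_(i < N)
      (c i * (4 * (b i * (b i + m + q i)))%:R * inner x x ^+ (b i).-1)
      * (inner y' y' ^+ b i
         * hgeg m (q i) (inner y' x) (inner y' y' * inner x x)).
  apply/funext => y'.
  have -> : (fun x' : 'rV[R]_n => \sum_(i < N) c i
      * ((inner x' x' * inner y' y') ^+ b i
         * hgeg m (q i) (inner x' y') (inner x' x' * inner y' y')))
    = fun x' => \sum_(i < N) (c i * inner y' y' ^+ b i) * (inner x' x' ^+ b i
         * hgeg m (q i) (inner x' y') (inner x' x' * inner y' y')).
    by apply/funext => x'; apply: eq_bigr => i _; rewrite exprMn; ring.
  rewrite laplacian_hgeg_sum//; apply: eq_bigr => i _.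
  by rewrite (innerC y') (mulrC (inner y' y')); ring.
rewrite laplacian_hgeg_sum//; apply: eq_bigr => i _.
by rewrite (innerC y x) (mulrC (inner y y)) exprMn; ring.
Qed.

(** With truncated subtraction the product contains a zero factor as soon as [b i < l]; this is how
    the lower terms die. *)
Lemma iter_bilaplacian_hgeg_sum (R : realType) (n m l N : nat) (c : 'I_N -> R)
    (b q : 'I_N -> nat) :
  n = (2 * m + 2)%N ->
  iter l (fun F => laplacian_y (laplacian_x F))
    (fun x y : 'rV[R]_n => \sum_(i < N) c i * ((inner x x * inner y y) ^+ b i
         * hgeg m (q i) (inner x y) (inner x x * inner y y)))
  = fun x y => \sum_(i < N)
      c i * (\prod_(k < l) (4 * ((b i - k) * (b i - k + m + q i))))%:R ^+ 2
      * ((inner x x * inner y y) ^+ (b i - l)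
         * hgeg m (q i) (inner x y) (inner x x * inner y y)).
Proof.
move=> hn; elim: l => [|l IH] /=.
  apply/funext => x; apply/funext => y; apply: eq_bigr => i _.
  by rewrite big_ord0 expr1n mulr1 subn0.
rewrite IH bilaplacian_hgeg_sum//; apply/funext => x; apply/funext => y.
apply: eq_bigr => i _; rewrite big_ord_recr /= subnS [in RHS]natrM.
by rewrite -(mulrA (c i)) -exprMn.
Qed.

(** * Evaluation of the constant *)

Lemma prod_fact (m t : nat) :
  ((\prod_(k < m) (4 * ((m - k) * (m - k + t)))) * t`!
   = 4 ^ m * m`! * (m + t)`!)%N.
Proof.
elim: m => [|m IH]; first by rewrite big_ord0 !mul1n.
rewrite big_ord_recl /= subn0 -mulnA IH expnS addSn !factS.
by ring.
Qed.

Theorem corollary3p6 (R : realType) (m k : nat) (hkm : (1 <= k + m)%N)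
    (x y : 'rV[R]_(2 * m + 2)) :
  iter m (fun F => laplacian_y (laplacian_x F))
    (@zonal R (2 * m + 2) 0 (k + 2 * m)) x y
  = beta_hat R m k * zonal m%:R k x y.
Proof.
pose p := (k + 2 * m)%N.
have p0 : (0 < p)%N by rewrite /p; lia.
have [|c [cm cE]] := @hgeg_connection R p m _ p0; first by rewrite /p; lia.
have -> : @zonal R (2 * m + 2) 0 (k + 2 * m) = fun x y => \sum_(i < m.+1) c i
    * ((inner x x * inner y y) ^+ i
       * hgeg m (p - 2 * i) (inner x y) (inner x x * inner y y)).
  apply/funext => x'; apply/funext => y'.
  rewrite -[0]/(0%:R) zonal_hgeg ?addn0// fact0 divr1 cE big_mkord.
  by apply: eq_bigr => i _; rewrite mulrA.
(* For i < m the product has the factor of index k = i, which contains i - i = 0. Only the term i =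
   m survives. *)
rewrite iter_bilaplacian_hgeg_sum// big_ord_recr big1 /= ?add0r; last first.
  move=> i _; rewrite [X in X%:R](_ : _ = 0%N) ?mul0r ?expr0n ?mulr0 ?mul0r//.
  by rewrite (bigD1 (Ordinal (ltn_ord i)))//= subnn mul0n.
rewrite zonal_hgeg// subnn expr0 mul1r (mulrA (beta_hat R m k)).
congr (_ * _); last first.
  by rewrite /p addnK.
(* It remains to multiply c_m = (-1)^m p (m+k)! / p! by the square of 4^m m! p! / (m+k)!, and to
   compare with [beta_hat] times the factor (k+m) / m! of the zonal harmonic. *)
rewrite cm /beta_hat.
have -> : (p - 2 * m = k)%N by rewrite /p addnK.
have -> : (p - m = m + k)%N by rewrite /p; lia.
under eq_bigr do rewrite -addnA.
have := prod_fact m (m + k).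
have -> : (m + (m + k) = p)%N by rewrite /p; lia.
move/(congr1 (fun n : nat => n%:R : R)); rewrite !natrM natrX => prodE.
have -> : (\prod_(i < m) (4 * ((m - i) * (m - i + (m + k)))))%:R
    = 4 ^+ m * m`!%:R * p`!%:R / (m + k)`!%:R :> R.
  by apply: (mulIf (fact_neq0 R (m + k))); rewrite divfK ?fact_neq0.
rewrite !Gamma_fact.
rewrite -/p (mulnC 2 m) exprM (addnC m k).
by field; rewrite !fact_neq0 -natrD pnatr_eq0 -lt0n hkm.
Qed.
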